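(* The simultaneous Post Correspondence Problem for free groups is decidable for immersions. That is, there exists an algorithm which, given finite alphabets $\Sigma,\Delta$ and a finite set $S$ of immersions from $F(\Sigma)$ to $F(\Delta)$, decides whether the subgroup $\operatorname{Eq}(S)$ is trivial.
   Context: $F(\Sigma)$ is the free group on $\Sigma$, viewed as the set of freely reduced words over $\Sigma\cup\Sigma^{-1}$. A group morphism $f:F(\Sigma)\to F(\Delta)$ is an immersion if for every $x\in\Sigma\cup\Sigma^{-1}$ the freely reduced word $f(x)$ is non-empty and, for distinct $x,y\in\Sigma\cup\Sigma^{-1}$, the freely reduced words $f(x)$ and $f(y)$ start with different letters of $\Delta\cup\Delta^{-1}$. For morphisms $g,h:F(\Sigma)\to F(\Delta)$ put $\operatorname{Eq}(g,h)=\{x\in F(\Sigma)\mid g(x)=h(x)\}$, and for a set $S$ of morphisms put $\operatorname{Eq}(S)=\bigcap_{g,h\in S}\operatorname{Eq}(g,h)$. A morphism $f:F(\Sigma)\to F(\Delta)$ is given as the list of reduced words $(f(a))_{a\in\Sigma}$. *)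

(* Defs.v *)
From HB Require Import structures.
From mathcomp Require Import all_boot.
From mathcomp Require Import boolp classical_sets.
From Stdlib Require List.

Set Implicit Arguments.
Unset Strict Implicit.
Unset Printing Implicit Defensive.

Local Open Scope classical_set_scope.
Local Open Scope group_scope.

(* (a, false) stands for the generator a and (a, true) for its inverse. *)
Definition letter (A : Type) : Type := (A * bool)%type.

Definition inv_letter (A : Type) (x : letter A) : letter A := (x.1, ~~ x.2).

Section FreeGroup.
Variable A : choiceType.
Implicit Types (x y : letter A) (u v w : seq (letter A)).

Definition reduced : pred (seq (letter A)) :=
  sorted (fun x y => y != inv_letter x).

Definition push x w : seq (letter A) :=
  if w is y :: w' then if y == inv_letter x then w' else x :: w else [:: x].

Definition reduce w : seq (letter A) := foldr push [::] w.

Definition inv_word w : seq (letter A) := rev (map (@inv_letter A) w).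

Record freegroup : Type := FreeGroup {
  fgword :> seq (letter A);
  _ : reduced fgword
}.

HB.instance Definition _ := [isSub for fgword].
HB.instance Definition _ := [Choice of freegroup by <:].

Lemma inv_letterK : involutive (@inv_letter A).
Proof. by case=> a b; rewrite /inv_letter /= negbK. Qed.

Lemma reduced_push x w : reduced w -> reduced (push x w).
Proof.
case: w => [//|y w] /= yw; case: ifPn => [_|nyx] /=; last by rewrite nyx.
exact: path_sorted yw.
Qed.

Lemma reduced_foldr_push u w : reduced w -> reduced (foldr push w u).
Proof. by move=> rw; elim: u => //= x u; apply: reduced_push. Qed.

Lemma pushK x w : reduced w -> push x (push (inv_letter x) w) = w.
Proof.
case: w => [|y w] /= yw; first by rewrite eqxx.
rewrite inv_letterK; case: eqVneq => [eyx|nyx]; last by rewrite /= eqxx.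
by subst y; case: w yw => [//|z w] /= /andP[/negPf ->].
Qed.

Lemma foldr_push_push x u w : reduced w ->
  foldr push w (push x u) = push x (foldr push w u).
Proof.
move=> rw; case: u => [//|y u] /=; case: eqVneq => [->|//].
by rewrite pushK // reduced_foldr_push.
Qed.

Lemma foldr_push_reduce u w : reduced w ->
  foldr push w (reduce u) = foldr push w u.
Proof. by move=> rw; elim: u => //= x u IHu; rewrite foldr_push_push ?IHu. Qed.

Lemma reduced_reduce w : reduced (reduce w).
Proof. exact: reduced_foldr_push. Qed.

Lemma reduce_id w : reduced w -> reduce w = w.
Proof.
elim: w => //= x w IHw xw; rewrite IHw; last exact: path_sorted xw.
by case: w xw {IHw} => // y w /= /andP[/negPf ->].
Qed.

Lemma reduced_inv_word w : reduced w -> reduced (inv_word w).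
Proof.
rewrite /reduced /inv_word rev_sorted sorted_map; apply: sub_sorted => x y /=.
by rewrite inv_letterK eq_sym.
Qed.

Lemma inv_wordK : involutive inv_word.
Proof. by move=> w; rewrite /inv_word map_rev revK mapK //; exact: inv_letterK. Qed.

Definition fgone : freegroup := @FreeGroup [::] isT.
Definition fgmul (u v : freegroup) : freegroup :=
  FreeGroup (reduced_reduce (u ++ v)).
Definition fginv (u : freegroup) : freegroup :=
  FreeGroup (reduced_inv_word (valP u)).

Lemma fgmulE (u v : freegroup) : fgmul u v = foldr push v u :> seq (letter A).
Proof. by rewrite /= /reduce foldr_cat -/(reduce v) reduce_id ?(valP v). Qed.

Lemma fgmulA : associative fgmul.
Proof.
move=> u v w; apply: val_inj; rewrite [LHS]fgmulE [RHS]fgmulE fgmulE.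
by rewrite [X in foldr _ _ X = _]/= foldr_push_reduce ?(valP w) // foldr_cat.
Qed.

Lemma fgmul1g : left_id fgone fgmul.
Proof. by move=> u; apply: val_inj; rewrite [LHS]fgmulE. Qed.

Lemma fgmulg1 : right_id fgone fgmul.
Proof. by move=> u; apply: val_inj; rewrite /= cats0 reduce_id ?(valP u). Qed.

Lemma fgmulVg : left_inverse fgone fginv fgmul.
Proof.
move=> [u ru]; apply: val_inj; rewrite [LHS]fgmulE /= {ru}.
elim: u => //= x u IHu; rewrite /inv_word /= rev_cons foldr_rcons /=.
by rewrite inv_letterK eqxx.
Qed.

Lemma fginvK : involutive fginv.
Proof. by move=> u; apply: val_inj; rewrite /= inv_wordK. Qed.

Lemma fgmulgV : right_inverse fgone fginv fgmul.
Proof. by move=> u; rewrite -[X in fgmul X _]fginvK fgmulVg. Qed.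

HB.instance Definition _ :=
  isGroup.Build freegroup fgmulA fgmul1g fgmulg1 fgmulVg fgmulgV.

Definition fgletter x : freegroup := @FreeGroup [:: x] isT.

End FreeGroup.

Section Morphisms.
Variables Sigma Delta : choiceType.
Implicit Types f g h : {multiplicative freegroup Sigma -> freegroup Delta}.

Definition immersion f : Prop :=
  (forall x : letter Sigma, fgword (f (fgletter x)) <> [::]) /\
  (forall x y : letter Sigma, x <> y ->
     ohead (fgword (f (fgletter x))) <> ohead (fgword (f (fgletter y)))).

Definition equaliser g h : set (freegroup Sigma) := [set x | g x = h x].

Definition equaliser_set
    (S : set {multiplicative freegroup Sigma -> freegroup Delta}) :
    set (freegroup Sigma) :=
  \bigcap_(g in S) \bigcap_(h in S) equaliser g h.

End Morphisms.

(* Algorithms are the programs of the Turing-complete WHILE language of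
   N. D. Jones, Computability and Complexity from a Programming Perspective,
   MIT Press, 1997, with Nil as the only atom. *)

Inductive tree : Type := Nil | Cons of tree & tree.

Fixpoint tree_eqb (s t : tree) : bool :=
  match s, t with
  | Nil, Nil => true
  | Cons s1 s2, Cons t1 t2 => tree_eqb s1 t1 && tree_eqb s2 t2
  | _, _ => false
  end.

Lemma tree_eqP : Equality.axiom tree_eqb.
Proof.
elim=> [|s1 IH1 s2 IH2] [|t1 t2] /=; try by constructor.
by apply: (iffP andP) => [[/IH1-> /IH2->] //|[<- <-]]; split; [exact/IH1|exact/IH2].
Qed.

HB.instance Definition _ := hasDecEq.Build tree tree_eqP.

Definition tree_hd (t : tree) : tree := if t is Cons s _ then s else Nil.
Definition tree_tl (t : tree) : tree := if t is Cons _ s then s else Nil.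

Definition code_bool (b : bool) : tree := if b then Cons Nil Nil else Nil.

Inductive expr : Type :=
  | EVar of nat
  | ENil
  | ECons of expr & expr
  | EHd of expr
  | ETl of expr
  | EEq of expr & expr.

Inductive program : Type :=
  | Assign of nat & expr
  | Seq of program & program
  | While of expr & program.

Definition store : Type := nat -> tree.

Definition update (s : store) (i : nat) (t : tree) : store :=
  fun j => if j == i then t else s j.

Fixpoint eval (s : store) (e : expr) : tree :=
  match e with
  | EVar i => s i
  | ENil => Nil
  | ECons e1 e2 => Cons (eval s e1) (eval s e2)
  | EHd e1 => tree_hd (eval s e1)
  | ETl e1 => tree_tl (eval s e1)
  | EEq e1 e2 => code_bool (eval s e1 == eval s e2)
  end.

(* Big-step semantics: exec p s s' holds when p, started in the store s,
   terminates in the store s'.  Nil is the only false value. *)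
Inductive exec : program -> store -> store -> Prop :=
  | exec_assign i e s : exec (Assign i e) s (update s i (eval s e))
  | exec_seq p q s s' s'' :
      exec p s s' -> exec q s' s'' -> exec (Seq p q) s s''
  | exec_while_false e p s : eval s e = Nil -> exec (While e p) s s
  | exec_while_true e p s s' s'' :
      eval s e <> Nil -> exec p s s' -> exec (While e p) s' s'' ->
      exec (While e p) s s''.

Lemma exec_det p s s1 s2 : exec p s s1 -> exec p s s2 -> s1 = s2.
Proof.
move=> e1; elim: e1 s2 => {p s s1}.
- by move=> i e s s2 e2; inversion e2.
- by move=> p q s s' s'' _ IHp _ IHq s2 e2; inversion e2; subst;
    apply: IHq; rewrite (IHp s'0).
- by move=> e p s es s2 e2; inversion e2; subst.
- move=> e p s s' s'' es _ IHp _ IHw s2 e2; inversion e2; subst => //.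
  by apply: IHw; rewrite (IHp s'0).
Qed.

(* The input is read in variable 0, all the other variables being initially
   Nil, and the output is the final value of variable 0. *)
Definition computes (p : program) (input output : tree) : Prop :=
  exists2 s : store,
    exec p (update (fun=> Nil) 0 input) s & s 0 = output.

(* By exec_det, the answer b is unique. *)
Definition decides (p : program) (input : tree) (P : Prop) : Prop :=
  exists2 b : bool, (b <-> P) & computes p input (code_bool b).

Definition code_nat (n : nat) : tree := iter n (Cons Nil) Nil.

Definition code_seq (T : Type) (code : T -> tree) (s : seq T) : tree :=
  foldr (fun x t => Cons (code x) t) Nil s.

Definition code_letter (A : finType) (x : letter A) : tree :=
  Cons (code_nat (enum_rank x.1)) (code_bool x.2).

Definition code_fg (A : finType) (u : freegroup A) : tree :=
  code_seq (@code_letter A) u.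

(* The morphism f is given by the reduced words f(a), a in Sigma. *)
Definition code_morphism (Sigma Delta : finType)
    (f : {multiplicative freegroup Sigma -> freegroup Delta}) : tree :=
  code_seq (@code_fg Delta) [seq f (fgletter (a, false)) | a <- enum Sigma].

Definition code_instance (Sigma Delta : finType)
    (S : seq {multiplicative freegroup Sigma -> freegroup Delta}) : tree :=
  Cons (code_nat #|Sigma|) (Cons (code_nat #|Delta|)
    (code_seq (@code_morphism Sigma Delta) S)).

(* Main.v *)
From Pilot Require Import Defs.
From HB Require Import structures.
From mathcomp Require Import all_boot.
From mathcomp Require Import boolp classical_sets.
From Stdlib Require List.
Import Pilot.Defs.

Set Implicit Arguments.
Unset Strict Implicit.
Unset Printing Implicit Defensive.

(** An immersion sends distinct letters to words with distinct first letters, and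
    applied to a reduced word it concatenates the images of the letters without
    any cancellation.  It is thus a marked morphism of free monoids on the
    alphabet of letters and their inverses.  If several immersions agree, as
    monoid morphisms, on a nonempty word w, then they agree on its longest
    reduced prefix: their common value stops being reduced exactly there
    (agree_reduced).  So the question is whether finitely many marked morphisms
    agree on some nonempty word, and it is settled by a computable bound on the
    length of a shortest such word; the program tries all the words up to the
    bound.

    For a pair (g, h) of marked morphisms, the pairs (u, v) with g(u) = h(v) are
    closed under longest common prefixes taken coordinate by coordinate
    (lcp_solution).  Hence at most one minimal pair, or block, has a value
    starting with a given letter c.  Sending c to the two components of this
    block gives the reduct of (g, h), again a pair of marked morphisms, whose
    equaliser is mapped onto that of (g, h) by its first component.  The words
    of the equaliser have a unique factorisation into prime ones, and a prime
    word is determined by its first letter (prime_uniq).  Passing to the reduct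
    strictly shortens a prime word until a single letter is left
    (prime_reduct_size).  On the other hand, reduction does not increase the
    number of proper suffixes of the values of the morphisms
    (suffix_complexity_reduct), which bounds the lengths of these values; only
    finitely many pairs can occur, and none recurs with the same first letter,
    because the prime word would have to be the same while its length has
    dropped.  This bounds the number of reductions, hence the length of a prime
    word (prime_size).

    For more than two morphisms, the words on which all agree form the
    intersection of the equalisers of the first one with each of the others.
    As each of these monoids is generated by words of bounded length, pumping
    bounds the shortest nonempty word of the intersection
    (short_intersection).

    To write the program, functions on trees are shown computable by closure
    under composition, pairing, projections, equality tests and folds along the
    right spine; a stack kept in one variable makes programs compose. *)

(** * Marked morphisms of free monoids *)

Section Image.
Variables X Y : eqType.
Implicit Types (g : X -> seq Y) (u v w : seq X) (x y : X).

Definition im g w : seq Y := flatten (map g w).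

(** A morphism of monoids may be partial: the empty word as value of a letter
    marks the letter as outside the domain. *)
Definition defined g w : bool := all (fun x => g x != [::]) w.

Definition marked g : Prop :=
  forall x y c, ohead (g x) = Some c -> ohead (g y) = Some c -> x = y.

Lemma im_cat g u v : im g (u ++ v) = im g u ++ im g v.
Proof. by rewrite /im map_cat flatten_cat. Qed.

Lemma im_cons g x w : im g (x :: w) = g x ++ im g w.
Proof. by []. Qed.

End Image.

Section Marked.
Variable T : choiceType.
Implicit Types (g h : T -> seq T) (s t u v w : seq T) (c x y : T).

Lemma defined_cat g u v : defined g (u ++ v) = defined g u && defined g v.
Proof. exact: all_cat. Qed.

Lemma defined_prefix g u w : prefix u w -> defined g w -> defined g u.
Proof. by move=> /prefixP[v ->]; rewrite defined_cat => /andP[]. Qed.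

Lemma im_nil g w : defined g w -> im g w = [::] -> w = [::].
Proof. by case: w => //= x w /andP[+ _]; rewrite im_cons; case: (g x). Qed.

Lemma size_im g w : defined g w -> size w <= size (im g w).
Proof.
elim: w => //= x w IHw /andP[gx dw]; rewrite im_cons size_cat -add1n.
by rewrite leq_add ?IHw // lt0n size_eq0.
Qed.

Lemma size_im_le g n w : (forall x, size (g x) <= n) -> size (im g w) <= n * size w.
Proof.
move=> gn; elim: w => [|x w IHw]; first by rewrite muln0.
by rewrite im_cons size_cat mulnS leq_add.
Qed.

(** What remains of two words after their longest common prefix. *)
Definition diverge u v : Prop :=
  forall x u' v', u = x :: u' -> v = x :: v' -> False.

Lemma lcp_split u v :
  exists p a b, [/\ u = p ++ a, v = p ++ b & diverge a b].
Proof.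
elim: u v => [|x u IHu] v; first by exists [::], [::], v; split.
case: v => [|y v]; first by exists [::], (x :: u), [::]; split.
have [<-|nxy] := eqVneq x y; last first.
  exists [::], (x :: u), (y :: v); split=> // z u' v' [zx _] [zy _].
  by rewrite zx zy eqxx in nxy.
have [p [a [b [-> -> ab]]]] := IHu v.
by exists (x :: p), a, b; split.
Qed.

Lemma cat_eq_split u v u' v' : u ++ v = u' ++ v' -> size u <= size u' ->
  exists2 z, u' = u ++ z & v = z ++ v'.
Proof.
elim: u u' => [|x u IHu] [|x' u'] //=; first by exists [::].
  by exists (x' :: u').
by case=> <- e le; have [z -> ->] := IHu u' e le; exists z.
Qed.

Lemma lcp_size_le g s t p a b e f :
  marked g -> defined g a -> defined g b -> diverge a b ->
  (s ++ im g p) ++ im g a = t ++ e -> (s ++ im g p) ++ im g b = t ++ f ->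
  size t <= size (s ++ im g p).
Proof.
move=> mg + + ab ea eb; rewrite leqNgt => da db; apply/negP => lt.
have [z tz az] := cat_eq_split ea (ltnW lt).
have [z' tz' bz] := cat_eq_split eb (ltnW lt).
have ez : z' = z.
  by apply/eqP; move/eqP: tz'; rewrite tz eqseq_cat // eqxx eq_sym.
case: z => [|z0 z] in tz az ez; first by rewrite tz cats0 ltnn in lt.
have starts w w' : defined g w -> im g w = (z0 :: z) ++ w' ->
    exists x w1, w = x :: w1 /\ ohead (g x) = Some z0.
  case: w => [//|x w1] /= /andP[gx _]; rewrite im_cons => ew; exists x, w1; split=> //.
  by case: (g x) gx ew => //= y r _ [->].
have [x [a1 [ea1 hx]]] := starts _ _ da az; rewrite ez in bz.
have [y [b1 [eb1 hy]]] := starts _ _ db bz.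
by move: eb1; rewrite -(mg x y z0 hx hy); exact: (ab x a1 b1 ea1).
Qed.

(** The solutions (u, v) of s g(u) = t h(v) are closed under taking longest
    common prefixes in both coordinates: if the image of one of the two common
    prefixes were the shorter one, then both continuations on that side would
    have to produce the same letter, and would agree on their next letter. *)
Lemma lcp_solution g h s t p q a b a1 b1 : marked g -> marked h ->
  defined g (p ++ a) -> defined g (p ++ b) ->
  defined h (q ++ a1) -> defined h (q ++ b1) ->
  diverge a b -> diverge a1 b1 ->
  s ++ im g (p ++ a) = t ++ im h (q ++ a1) ->
  s ++ im g (p ++ b) = t ++ im h (q ++ b1) ->
  s ++ im g p = t ++ im h q.
Proof.
rewrite !defined_cat !im_cat !catA.
move=> mg mh /andP[_ da] /andP[_ db] /andP[_ dc] /andP[_ dd] ab cd ea eb.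
have sz : size (s ++ im g p) = size (t ++ im h q).
  apply/eqP; rewrite eqn_leq (lcp_size_le mg da db ab ea eb).
  by rewrite (lcp_size_le mh dc dd cd (esym ea) (esym eb)).
by move/eqP: ea; rewrite eqseq_cat // => /andP[/eqP].
Qed.

(** * Equalisers and blocks *)

Definition solution g h w : Prop := [/\ defined g w, defined h w & im g w = im h w].

Lemma solution_cat g h u v : solution g h u -> solution g h v -> solution g h (u ++ v).
Proof.
by move=> [gu hu e] [gv hv e']; split; rewrite ?defined_cat ?im_cat ?gu ?hu // e e'.
Qed.

Lemma solution_cancel g h u v : solution g h (u ++ v) -> solution g h u -> solution g h v.
Proof.
rewrite /solution !defined_cat !im_cat => -[/andP[_ gv] /andP[_ hv] e] [_ _ eu].
by split=> //; apply/eqP; move/eqP: e; rewrite eu eqseq_cat // eqxx.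
Qed.

Definition prime_solution g h w : Prop :=
  [/\ solution g h w, w <> [::] &
      forall u, prefix u w -> solution g h u -> u <> [::] -> u = w].

Lemma prime_prefix g h w : solution g h w -> w <> [::] ->
  exists2 u, prime_solution g h u & prefix u w.
Proof.
elim: {w}(size w) {-2}w (leqnn (size w)) => [|n IHn] w wn ew nw.
  by case: w wn nw {ew}.
have [pw|/existsNP[u /not_implyP[uw /not_implyP[eu /not_implyP[nu nuw]]]]] :=
  pselect (forall u, prefix u w -> solution g h u -> u <> [::] -> u = w).
  by exists w => //; exact: prefix_refl.
have un : size u <= n.
  move/prefixP: uw => [v wE]; rewrite -ltnS (leq_trans _ wn) // wE size_cat.
  case: v wE => [|x v] wE; last by rewrite /= addnS ltnS leq_addr.
  by case: nuw; rewrite wE cats0.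
have [u' pu' u'u] := IHn u un eu nu.
by exists u' => //; exact: prefix_trans u'u uw.
Qed.

(** The longest common prefix of two solutions is a solution. *)
Lemma prime_uniq g h u v x : marked g -> marked h ->
  prime_solution g h u -> prime_solution g h v ->
  ohead u = Some x -> ohead v = Some x -> u = v.
Proof.
move=> mg mh [[gu hu eu] nu pu] [[gv hv ev] nv pv] ux vx.
have [p [a [b [uE vE ab]]]] := lcp_split u v.
have ep : solution g h p.
  move: gu hu eu gv hv ev; rewrite uE vE => gu hu eu gv hv ev; split.
  - by move: gu; rewrite defined_cat => /andP[].
  - by move: hu; rewrite defined_cat => /andP[].
  - exact: (@lcp_solution g h [::] [::] p p a b a b).
have np : p <> [::].
  move=> p0; rewrite p0 /= in uE vE.
  case: a uE ab => [|y a] uE ab; first by rewrite uE in ux.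
  case: b vE ab => [|z b] vE ab; first by rewrite vE in vx.
  move: ux vx; rewrite uE vE => -[yx] [zx].
  by apply: (ab x a b); rewrite ?yx ?zx.
have pu' : prefix p u by rewrite uE prefix_prefix.
have pv' : prefix p v by rewrite vE prefix_prefix.
by transitivity p; [apply/esym/pu|apply: pv].
Qed.

(** A minimal pair with g(u) = h(v); c is the first letter of the common value. *)
Definition block g h c u v : Prop :=
  [/\ defined g u, defined h v, im g u = im h v, ohead (im g u) = Some c &
    forall u1 v1, prefix u1 u -> prefix v1 v -> im g u1 = im h v1 ->
      u1 <> [::] -> u1 = u /\ v1 = v].

Lemma block_sym g h c u v : block g h c u v -> block h g c v u.
Proof.
move=> [gu hv e c1 min]; split=> //; first by rewrite -e.
move=> v1 u1 pv pu e1 nv.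
have nu : u1 <> [::].
  move=> u10; case: nv; apply: (@im_nil h); first exact: defined_prefix pv hv.
  by rewrite e1 u10.
by have [-> ->] := min u1 v1 pu pv (esym e1) nu.
Qed.

(** The longest common prefixes of two blocks with the same first letter c form a
    pair with equal values.  It is not empty, because a marked morphism leaves
    no choice for the first letter of u and u', so it is both blocks. *)
Lemma block_uniq g h c u v u' v' : marked g -> marked h ->
  block g h c u v -> block g h c u' v' -> u = u' /\ v = v'.
Proof.
move=> mg mh [gu hv e cu min] [gu' hv' e' cu' min'].
have [p [a [b [uE uE' ab]]]] := lcp_split u u'.
have [q [a1 [b1 [vE vE' ab1]]]] := lcp_split v v'.
have ep : im g p = im h q.
  apply: (@lcp_solution g h [::] [::] p q a b a1 b1) => //;
  by rewrite -?uE -?uE' -?vE -?vE'.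
have np : p <> [::].
  move=> p0; rewrite p0 /= in uE uE'.
  have starts w : defined g w -> ohead (im g w) = Some c ->
      exists x w1, w = x :: w1 /\ ohead (g x) = Some c.
    case: w => [//|x w1] /= /andP[gx _]; rewrite im_cons => cw; exists x, w1.
    by split=> //; case: (g x) gx cw.
  have [x [w [uw xc]]] := starts u gu cu; have [y [w' [uw' yc]]] := starts u' gu' cu'.
  by apply: (ab x w w'); rewrite -?uE -?uE' // uw' (mg x y c xc yc).
have [pu pv] : prefix p u /\ prefix q v by rewrite uE vE !prefix_prefix.
have [pu' pv'] : prefix p u' /\ prefix q v' by rewrite uE' vE' !prefix_prefix.
have [eu ev] := min p q pu pv ep np; have [eu' ev'] := min' p q pu' pv' ep np.
by split; congruence.
Qed.

(** The letters of the new alphabet are the first letters c of the values of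
    blocks; the empty word marks the letters that start no block.  The reduct of
    the pair (g, h) is the pair (reduct g h, reduct h g). *)
Definition reduct g h c : seq T := xget [::] [set u | exists v, block g h c u v].

Lemma reductE g h c u v : marked g -> marked h -> block g h c u v ->
  reduct g h c = u.
Proof.
move=> mg mh b; apply: xget_unique => [|u' [v' b']]; first by exists v.
by have [] := block_uniq mg mh b b'.
Qed.

Lemma reductP g h c : marked g -> marked h -> reduct g h c <> [::] ->
  block g h c (reduct g h c) (reduct h g c).
Proof.
move=> mg mh; rewrite {1 2}/reduct; case: xgetP => // u _ [v b] _.
by rewrite (reductE mh mg (block_sym b)).
Qed.

Lemma reduct_nil g h c : marked g -> marked h ->
  (reduct g h c == [::]) = (reduct h g c == [::]).
Proof.
suff imp g' h' : marked g' -> marked h' -> reduct g' h' c = [::] -> reduct h' g' c = [::].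
  by move=> mg mh; apply/eqP/eqP; exact: imp.
move=> mg mh r0; apply: contrapT => /(reductP mh mg)[_ _ + + _].
by rewrite r0 => ->.
Qed.

Lemma reduct_defined g h w : marked g -> marked h ->
  defined (reduct g h) w = defined (reduct h g) w.
Proof. by move=> mg mh; apply: eq_all => c; rewrite reduct_nil. Qed.

(** If g x starts with c, then c is recovered from the first letter x of the
    block. *)
Lemma marked_reduct g h : marked g -> marked h -> marked (reduct g h).
Proof.
move=> mg mh c d x cx dx.
have starts e : ohead (reduct g h e) = Some x -> ohead (g x) = Some e.
  move=> ex; have [|gu _ _ + _] := @reductP g h e mg mh; first by move=> e0; rewrite e0 in ex.
  case: (reduct g h e) ex gu => //= y u [->] /andP[gx _].
  by rewrite im_cons; case: (g x) gx.
by have := starts _ cx; rewrite (starts _ dx) => -[].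
Qed.

Lemma reduct_im_defined g h w : marked g -> marked h ->
  defined (reduct g h) w -> defined g (im (reduct g h) w) /\
  im g (im (reduct g h) w) = im h (im (reduct h g) w).
Proof.
move=> mg mh; elim: w => //= c w IHw /andP[/eqP rc /IHw[dw ew]].
have [gu hv e _ _] := reductP mg mh rc.
by rewrite !im_cons !im_cat defined_cat gu dw e ew.
Qed.

(** The shortest nonempty initial pair with equal values is a block; what remains
    after it is a shorter pair with equal values. *)
Lemma block_factor g h u v : marked g -> marked h -> defined g u -> defined h v ->
  im g u = im h v -> exists w, [/\ defined (reduct g h) w,
    im (reduct g h) w = u & im (reduct h g) w = v].
Proof.
move=> mg mh.
elim: {u}(size u) {-2}u (leqnn (size u)) v => [|n IHn] u un v gu hv e.
  case: u un gu e => // _ _ /esym/im_nil-/(_ hv) ->.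
  by exists [::].
have [u0|nu] := pselect (u = [::]).
  by apply: IHn => //; rewrite u0.
pose P k := `[< exists u1 v1, [/\ prefix u1 u, prefix v1 v, im g u1 = im h v1,
   u1 <> [::] & size u1 = k] >].
have exP : exists k, P k.
  by exists (size u); apply/asboolP; exists u, v; split=> //; exact: prefix_refl.
case: (ex_minnP exP) => k /asboolP[u1 [v1 [pu pv e1 nu1 su1]]] mink.
have [x hx] : exists x, ohead (im g u1) = Some x.
  case E: (im g u1) => [|x r]; last by exists x.
  by case: nu1; apply: im_nil E; exact: defined_prefix pu gu.
have gu1 := defined_prefix pu gu; have hv1 := defined_prefix pv hv.
have b : block g h x u1 v1.
  split=> // u2 v2 pu2 pv2 e2 nu2.
  have /mink : P (size u2).
    apply/asboolP; exists u2, v2; split=> //.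
      exact: prefix_trans pu2 pu.
    exact: prefix_trans pv2 pv.
  rewrite -su1 => le; case/prefixP: pu2 => u3 u1E.
  have u30 : u3 = [::].
    move: le; rewrite u1E size_cat -{2}[size u2]addn0 leq_add2l leqn0.
    by move/nilP.
  rewrite u30 cats0 in u1E; split=> //.
  case/prefixP: pv2 => v3 v1E; move: e1 hv1.
  rewrite u1E e2 v1E im_cat defined_cat => /eqP.
  rewrite -{1}[im h v2]cats0 eqseq_cat // eqxx => /eqP/esym h0 /andP[_].
  by move=> /im_nil-> //; rewrite cats0.
case/prefixP: pu => u2 uE; case/prefixP: pv => v2 vE.
have [||||w [dw w1 w2]] := IHn u2 _ v2.
- rewrite -ltnS (leq_trans _ un) // uE size_cat -add1n leq_add2r.
  by case: (u1) nu1.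
- by move: gu; rewrite uE defined_cat => /andP[].
- by move: hv; rewrite vE defined_cat => /andP[].
- by move/eqP: e; rewrite uE vE !im_cat e1 eqseq_cat // eqxx => /eqP.
exists (x :: w); rewrite !im_cons w1 w2 (reductE mg mh b).
rewrite (reductE mh mg (block_sym b)) uE vE; split=> //=.
by rewrite (reductE mg mh b) dw andbT; apply/eqP.
Qed.

Lemma solution_reduct g h w : marked g -> marked h ->
  solution (reduct g h) (reduct h g) w -> solution g h (im (reduct g h) w).
Proof.
move=> mg mh [dw dw' e]; have [d1 e1] := reduct_im_defined mg mh dw.
have [d2 e2] := reduct_im_defined mh mg dw'.
by split=> //; [rewrite e|rewrite e1 e].
Qed.

Lemma prime_reduct g h w : marked g -> marked h -> prime_solution g h w ->
  exists2 w', prime_solution (reduct g h) (reduct h g) w' & im (reduct g h) w' = w.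
Proof.
move=> mg mh [[gw hw e] nw pw].
have [w' [dw' w1 w2]] := block_factor mg mh gw hw e.
exists w' => //; split.
- by split; [|rewrite -reduct_defined|rewrite w1 w2].
- by move=> w0; rewrite w0 in w1; case: nw.
- move=> u /prefixP[v wE] eu nu.
  have du : defined (reduct g h) u by case: eu.
  have /pw : prefix (im (reduct g h) u) w by rewrite -w1 wE im_cat prefix_prefix.
  move=> /(_ (solution_reduct mg mh eu)) uw.
  have {}uw : im (reduct g h) u = w by apply: uw => /(im_nil du).
  move: dw'; rewrite wE defined_cat => /andP[_ dv].
  suff v0 : im (reduct g h) v = [::] by rewrite (im_nil dv v0) cats0.
  apply/eqP; move/eqP: w1; rewrite wE im_cat uw -{2}[w]cats0 eqseq_cat //.
  by rewrite eqxx.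
Qed.

(** A prime solution that is as long as its image consists of letters that g and h
    send to letters.  The first one has the same image under both, so that it is
    a solution by itself.  When (g, h) is the reduct of another pair, the image
    is the prime solution of that pair from which w comes. *)
Lemma prime_reduct_size g h w : prime_solution g h w ->
  size w < size (im g w) \/ size w = 1.
Proof.
move=> [[gw hw e] nw pw].
have [lt|ge] := ltnP (size w) (size (im g w)); [by left|right].
case: w => [//|c w] in gw hw e nw pw ge *.
have single k : defined k (c :: w) -> size (im k (c :: w)) <= size (c :: w) ->
    exists x, k c = [:: x].
  move=> /= /andP[kc kw]; rewrite im_cons size_cat.
  case: (k c) kc => [//|x [|y r]] _; first by exists x.
  rewrite /= addSn addSn ltnS ltnNge; case/negP.
  by rewrite (leq_trans (size_im kw)) // leq_addl.
have [x gc] := single g gw ge.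
have [y hc] : exists y, h c = [:: y] by apply: single => //; rewrite -e.
suff <- : [:: c] = c :: w by [].
apply: pw => //; first by rewrite /= eqxx prefix0s.
by move: e; rewrite /solution /defined /im /= gc hc /= => -[-> _].
Qed.

(** * Suffix complexity *)

(** Bounding the number of proper suffixes instead of the lengths of the values
    gives a measure that reduction does not increase. *)
Definition suffix_complexity g n : Prop :=
  exists2 ss : seq (seq T), size ss <= n &
    forall x p s, g x = p ++ s -> p <> [::] -> s <> [::] -> s \in ss.

(** A word of length k has k - 1 nonempty proper suffixes, of distinct lengths. *)
Lemma size_suffix_complexity g n x : suffix_complexity g n -> size (g x) <= n.+1.
Proof.
move=> [ss ssn gss]; rewrite -ltnS -[_ < _]/(_ <= _).
case E: (g x) => [//|y w]; rewrite /= !ltnS.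
rewrite (leq_trans _ ssn) //.
pose sf := [seq drop i w | i <- iota 0 (size w)].
have <- : size sf = size w by rewrite size_map size_iota.
apply: uniq_leq_size.
  rewrite map_inj_in_uniq ?iota_uniq // => i j; rewrite !mem_iota /= add0n => ile jle.
  move=> /(congr1 size); rewrite !size_drop => e.
  by rewrite -[i](subKn (ltnW ile)) e subKn // ltnW.
move=> s /mapP[i]; rewrite mem_iota add0n => /andP[_ ile] ->.
apply: (gss x (y :: take i w)) => //; first by rewrite E /= cat_take_drop.
by move/(congr1 size); rewrite size_drop /= => /eqP; rewrite subn_eq0 leqNgt ile.
Qed.

(** Inside a block, after u1 and v1 have been read, one of the values is ahead of
    the other by an overflow s.  The minimal pair that completes the block
    depends on s alone. *)
Definition completes g h s u v : Prop :=
  [/\ defined g u, defined h v, im g u = s ++ im h v &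
    forall u1 v1, prefix u1 u -> prefix v1 v -> im g u1 = s ++ im h v1 -> u1 = u].

Lemma completes_uniq g h s u v u' v' : marked g -> marked h ->
  completes g h s u v -> completes g h s u' v' -> u = u'.
Proof.
move=> mg mh [gu hv e min] [gu' hv' e' min'].
have [p [a [b [uE uE' ab]]]] := lcp_split u u'.
have [q [a1 [b1 [vE vE' ab1]]]] := lcp_split v v'.
have ep : im g p = s ++ im h q.
  apply: (@lcp_solution g h [::] s p q a b a1 b1) => //;
  by rewrite -?uE -?uE' -?vE -?vE'.
have [pu pv] : prefix p u /\ prefix q v by rewrite uE vE !prefix_prefix.
have [pu' pv'] : prefix p u' /\ prefix q v' by rewrite uE' vE' !prefix_prefix.
by have := min p q pu pv ep; have := min' p q pu' pv' ep; congruence.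
Qed.

Lemma im_split h v s1 s2 : im h v = s1 ++ s2 ->
  (exists v1 v2, v = v1 ++ v2 /\ s1 = im h v1) \/
  (exists v1 y v2 t s, [/\ v = v1 ++ y :: v2, s1 = im h v1 ++ t, h y = t ++ s,
     t <> [::] & s <> [::]]).
Proof.
elim: v s1 => [|x v IHv] s1.
  by case: s1 => // _; left; exists [::], [::].
rewrite im_cons => e; have [le|lt] := leqP (size (h x)) (size s1).
  have [z s1E vE] := cat_eq_split e le.
  rewrite s1E.
  have [[v1 [v2 [-> ->]]]|[v1 [y [v2 [t [s [-> -> hy nt ns]]]]]]] := IHv z vE.
    by left; exists (x :: v1), v2.
  by right; exists (x :: v1), y, v2, t, s; split=> //; rewrite im_cons -catA.
have [z hxE _] := cat_eq_split (esym e) (ltnW lt).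
case: s1 => [|c s1] in e lt hxE *; first by left; exists [::], (x :: v).
right; exists [::], x, v, (c :: s1), z; split=> //.
by move=> z0; rewrite hxE z0 cats0 ltnn in lt.
Qed.

(** Cutting a block (u, v) inside u cuts v inside the image of one letter, where
    it leaves a proper suffix of a value of h; this suffix determines the rest
    of u. *)
Lemma suffix_complexity_reduct g h n : marked g -> marked h ->
  suffix_complexity h n -> suffix_complexity (reduct g h) n.
Proof.
move=> mg mh [ss ssn hss].
exists [seq xget [::] [set u | exists v, completes g h s u v] | s <- ss].
  by rewrite size_map.
move=> c u1 u2 rE nu1 nu2.
have [|gu hv e _ min] := @reductP g h c mg mh.
  by rewrite rE; case: (u1) nu1.
rewrite rE in gu e min; move: hv e min; set v := reduct h g c => hv e min.
move: (e); rewrite im_cat => /esym/im_split[[v1 [v2 [vE u1E]]]|].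
  case: nu2; have [] := min u1 v1; rewrite ?vE ?prefix_prefix //.
  by move/eqP; rewrite -{1}[u1]cats0 eqseq_cat // eqxx => /eqP.
move=> [v1 [y [v2 [t [s [vE u1E hy nt ns]]]]]].
have sss := hss _ _ _ hy nt ns.
apply/mapP; exists s => //; apply/esym.
have cs : completes g h s u2 v2.
  move: gu hv; rewrite vE !defined_cat /= => /andP[gu1 gu2] /and3P[_ _ hv2].
  split=> //.
    move: e; rewrite vE !im_cat im_cons u1E hy -!catA => /eqP.
    by rewrite eqseq_cat // eqxx eqseq_cat // eqxx => /eqP.
  move=> u3 v3 /prefixP[u4 u2E] /prefixP[v4 v2E] e3.
  have [] := min (u1 ++ u3) (v1 ++ y :: v3).
  - by rewrite u2E catA prefix_prefix.
  - by rewrite vE v2E -cat_cons catA prefix_prefix.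
  - by rewrite !im_cat im_cons e3 u1E hy -!catA.
  - by case: (u1) nu1.
  by move/eqP; rewrite eqseq_cat // eqxx => /eqP.
apply: xget_unique => [|u' [v' cs']]; first by exists v2.
exact/esym/(completes_uniq mg mh cs cs').
Qed.

End Marked.

(** * Bounds *)

(** The number of maps from b positions to m letters and a blank, that is, an
    upper bound on the number of words of length at most b over m letters. *)
Definition word_card (m b : nat) : nat := m.+1 ^ b.

(** With values of length at most l there are at most m * l proper suffixes, so
    that the values of all iterated reducts have length at most m * l + 1. *)
Definition value_bound (m l : nat) : nat := (m * l).+1.

(** The exponent is the number of configurations: two morphisms and a letter. *)
Definition prime_bound (m l : nat) : nat :=
  value_bound m l ^ (word_card m (value_bound m l) ^ m *
                     word_card m (value_bound m l) ^ m * m).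

(** The number of ways to choose, for each of k equalisers, the remainder of a
    generator. *)
Definition solution_bound (m l k : nat) : nat := word_card m (prime_bound m l) ^ k.

Section Bounds.
Variable T : finType.
Implicit Types (g h : T -> seq T) (s t u v w : seq T) (c x y : T).

Definition word_code b s : {ffun 'I_b -> option T} := [ffun i : 'I_b => onth s i].

Lemma word_code_inj b s t : size s <= b -> size t <= b ->
  word_code b s = word_code b t -> s = t.
Proof.
move=> sb tb e; apply: eq_from_onth => i.
have [ib|bi] := ltnP i b; last by rewrite !onth_default // (leq_trans _ bi).
by move/ffunP/(_ (Ordinal ib)): e; rewrite !ffunE.
Qed.

Lemma card_word_code b : #|{ffun 'I_b -> option T}| = word_card #|T| b.
Proof. by rewrite card_ffun card_ord card_option. Qed.

Definition config b : finType :=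
  ({ffun T -> {ffun 'I_b -> option T}} * {ffun T -> {ffun 'I_b -> option T}} * T)%type.

(** The identity of a prime solution in the sequence of reductions: the pair of
    morphisms, and the first letter of the solution. *)
Definition config_of b g h x : config b :=
  ([ffun y => word_code b (g y)], [ffun y => word_code b (h y)], x).

Lemma card_config b :
  #|config b| = word_card #|T| b ^ #|T| * word_card #|T| b ^ #|T| * #|T|.
Proof. by rewrite !card_prod !card_ffun card_ord card_option. Qed.

Lemma config_of_inj n g h x g' h' x' :
  suffix_complexity g n -> suffix_complexity h n ->
  suffix_complexity g' n -> suffix_complexity h' n ->
  config_of n.+1 g h x = config_of n.+1 g' h' x' -> [/\ g = g', h = h' & x = x'].
Proof.
move=> cg ch cg' ch' [eg eh ex]; split=> //; apply/funext => y.
  move/ffunP/(_ y): eg; rewrite !ffunE.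
  by apply: word_code_inj; apply: size_suffix_complexity.
move/ffunP/(_ y): eh; rewrite !ffunE.
by apply: word_code_inj; apply: size_suffix_complexity.
Qed.

(** V collects the configurations met on the way to the current pair: the pair
    of morphisms and the first letter of the prime solution, which together
    determine that solution.  As its length decreases, no configuration recurs,
    and d is the number of those that are left. *)
Lemma prime_size_visited n d (V : {set config n.+1}) g h w :
  marked g -> marked h -> suffix_complexity g n -> suffix_complexity h n ->
  prime_solution g h w -> #|V| + d = #|config n.+1| ->
  (forall g' h' x w', suffix_complexity g' n -> suffix_complexity h' n ->
     config_of n.+1 g' h' x \in V -> prime_solution g' h' w' -> ohead w' = Some x ->
     size w < size w') ->
  size w <= n.+1 ^ d.
Proof.
move=> mg mh cg ch pw cV big.
have [x wx] : exists x, ohead w = Some x.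
  by case: pw => _ + _; case: (w) => // x r _; exists x.
pose e := config_of n.+1 g h x.
have eV : e \notin V by apply/negP => /big/(_ pw wx); rewrite ltnn; auto.
elim: d V g h w mg mh cg ch pw x wx @e cV big eV
  => [|d IHd] V g h w mg mh cg ch pw x wx e cV big eV.
  by have := max_card (e |: V)%SET; rewrite cardsU1 eV add1n -cV addn0 ltnn.
have [w' pw' w'E] := prime_reduct mg mh pw.
have cg' := suffix_complexity_reduct mg mh ch.
have ch' := suffix_complexity_reduct mh mg cg.
have [lt|w'1] := prime_reduct_size pw'; last first.
  rewrite -w'E (leq_trans (size_im_le _ (fun y => size_suffix_complexity y cg'))) //.
  by rewrite w'1 muln1 expnS leq_pmulr // expn_gt0.
rewrite w'E in lt.
have big' g1 h1 x1 w1 : suffix_complexity g1 n -> suffix_complexity h1 n ->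
    config_of n.+1 g1 h1 x1 \in (e |: V)%SET -> prime_solution g1 h1 w1 ->
    ohead w1 = Some x1 -> size w' < size w1.
  move=> cg1 ch1; rewrite in_setU1 => /orP[/eqP e1|in1] pw1 wx1.
    have [eg eh ex] := config_of_inj cg1 ch1 cg ch e1.
    rewrite eg eh in pw1; rewrite ex in wx1.
    by rewrite (prime_uniq mg mh pw1 pw wx1 wx).
  exact: ltn_trans lt (big _ _ _ _ cg1 ch1 in1 pw1 wx1).
have [x' wx'] : exists x', ohead w' = Some x'.
  by case: pw' => _ + _; case: (w') => // y r _; exists y.
have {}IHd := IHd (e |: V)%SET _ _ w' (marked_reduct mg mh) (marked_reduct mh mg)
  cg' ch' pw' x' wx'.
rewrite -w'E (leq_trans (size_im_le _ (fun y => size_suffix_complexity y cg'))) //.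
rewrite expnS leq_mul2l /=; apply: IHd (big') _.
  by rewrite cardsU1 eV add1n addSnnS.
by apply/negP => /big'/(_ pw' wx'); rewrite ltnn; auto.
Qed.

Lemma suffix_complexity_size g l :
  (forall x, size (g x) <= l) -> suffix_complexity g (#|T| * l).
Proof.
move=> gl; exists [seq drop i (g x) | x <- enum T, i <- iota 1 l].
  by rewrite size_allpairs size_iota -cardE.
move=> x p s gx np _; have sE : s = drop (size p) (g x) by rewrite gx drop_size_cat.
rewrite sE; apply: (allpairs_f (fun x i => drop i (g x))); first exact: mem_enum.
rewrite mem_iota add1n ltnS lt0n size_eq0; apply/andP; split; first exact/eqP.
by rewrite (leq_trans _ (gl x)) // gx size_cat leq_addr.
Qed.

Lemma prime_size g h l w : marked g -> marked h ->
  (forall x, size (g x) <= l) -> (forall x, size (h x) <= l) ->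
  prime_solution g h w -> size w <= prime_bound #|T| l.
Proof.
move=> mg mh /suffix_complexity_size cg /suffix_complexity_size ch pw.
rewrite /prime_bound /value_bound -card_config.
apply: (prime_size_visited (V := finset.set0) mg mh cg ch pw); first by rewrite cards0.
by move=> g' h' x w' _ _; rewrite inE.
Qed.

Lemma solution_primes g h w : solution g h w ->
  exists2 us, w = flatten us & forall u, u \in us -> prime_solution g h u.
Proof.
elim: {w}(size w) {-2}w (leqnn (size w)) => [|n IHn] w wn ew.
  by exists [::] => //; case: w wn ew.
have [w0|nw] := pselect (w = [::]); first by exists [::].
have [u pu /prefixP[v wE]] := prime_prefix ew nw.
have [eu nu _] := pu; rewrite wE in ew.
have [|us vE usp] := IHn v _ (solution_cancel ew eu).
  rewrite -ltnS (leq_trans _ wn) // wE size_cat -add1n leq_add2r.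
  by case: (u) nu.
exists (u :: us); first by rewrite wE vE.
by move=> u'; rewrite inE => /orP[/eqP->|/usp].
Qed.

(** * Intersections *)

Section Intersection.
Variables (I : finType) (A : I -> seq T -> Prop) (b : nat).
Hypothesis A_nil : forall i, A i [::].
Hypothesis A_cat : forall i u v, A i u -> A i v -> A i (u ++ v).
Hypothesis A_short : forall i w, A i w ->
  exists2 us, w = flatten us & forall u, u \in us -> A i u /\ size u <= b.

(** The position j falls inside some generator, of which r is the part that is
    still to come. *)
Lemma cut_generator i w j : A i w -> exists r,
  [/\ size r <= b, A i (take j w ++ r) & exists2 y, drop j w = r ++ y & A i y].
Proof.
move=> /A_short[us -> usA].
have A_flatten vs : (forall u, u \in vs -> A i u /\ size u <= b) -> A i (flatten vs).
  elim: vs => //= v vs IHvs vsA; apply: A_cat.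
    by have [] := vsA v (mem_head _ _).
  by apply: IHvs => u uvs; apply: vsA; rewrite inE uvs orbT.
elim: us j usA => [|u us IHus] j usA.
  by exists [::]; rewrite cats0; split=> //; exists [::].
have [Au ub] := usA u (mem_head _ _).
have {}usA v : v \in us -> A i v /\ size v <= b.
  by move=> vus; apply: usA; rewrite inE vus orbT.
rewrite /= take_cat drop_cat; case: ltnP => [ju|uj].
  exists (drop j u); rewrite cat_take_drop; split=> //.
    by rewrite size_drop (leq_trans (leq_subr _ _)).
  by exists (flatten us) => //; exact: A_flatten.
have [r [rb Ar [y yE Ay]]] := IHus (j - size u) usA.
exists r; split=> //; last by exists y.
by rewrite -catA; exact: A_cat.
Qed.

(** Pumping: two positions in w at which every A i sees the same remainder of a
    generator can be identified. *)
Lemma short_intersection w : w <> [::] -> (forall i, A i w) ->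
  exists w', [/\ w' <> [::], forall i, A i w' & size w' <= word_card #|T| b ^ #|I|].
Proof.
(* The positions start at 1, so that what is left after a cut is not empty. *)
elim: {w}(size w) {-2}w (leqnn (size w)) => [|n IHn] w wn nw Aw.
  by case: w wn nw {Aw}.
have [le|gt] := leqP (size w) (word_card #|T| b ^ #|I|); first by exists w.
have cut (ij : I * 'I_(size w)) : exists r, [/\ size r <= b,
    A ij.1 (take ij.2.+1 w ++ r) & exists2 y, drop ij.2.+1 w = r ++ y & A ij.1 y].
  exact: cut_generator.
have [r rP] := boolp.choice cut.
pose f (j : 'I_(size w)) := [ffun i => word_code b (r (i, j))].
have /injectivePn[j [k nejk ejk]] : ~~ injectiveb f.
  apply/injectiveP => /leq_card; rewrite card_ord card_ffun card_word_code leqNgt.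
  by rewrite gt.
wlog jk : j k nejk ejk / j < k.
  move=> gen; have [jk|kj|/val_inj ejk'] := ltngtP j k; first exact: (gen j k).
    by apply: (gen k j) => //; rewrite eq_sym.
  by rewrite ejk' eqxx in nejk.
have kw := ltn_ord k.
apply: (IHn (take j.+1 w ++ drop k.+1 w)).
- rewrite -ltnS (leq_trans _ wn) // size_cat size_takel ?ltn_ord // size_drop.
  by rewrite -[X in _ < X](subnKC kw) ltn_add2r ltnS.
- by move/(congr1 size); rewrite size_cat size_takel ?ltn_ord.
- move=> i; have [rj Aj _] := rP (i, j); have [rk _ [y yE Ay]] := rP (i, k).
  rewrite /= in rj Aj rk yE Ay.
  have rjk : r (i, j) = r (i, k).
    by apply: (word_code_inj rj rk); move/ffunP/(_ i): ejk; rewrite !ffunE.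
  by rewrite yE -rjk catA; exact: A_cat.
Qed.

End Intersection.

Lemma short_solution (I : finType) (g : T -> seq T) (h : I -> T -> seq T) l w :
  marked g -> (forall i, marked (h i)) -> (forall x, size (g x) <= l) ->
  (forall i x, size (h i x) <= l) -> w <> [::] -> (forall i, solution g (h i) w) ->
  exists w', [/\ w' <> [::], forall i, solution g (h i) w' &
    size w' <= solution_bound #|T| l #|I|].
Proof.
move=> mg mh gl hl nw ew.
apply: (@short_intersection I (fun i => solution g (h i)) _ _ _ _ w) => //.
- by move=> i u v; exact: solution_cat.
- move=> i u /solution_primes[us uE usp]; exists us => // v /usp pv.
  by split; [case: pv|exact: (prime_size mg (mh i) gl (hl i) pv)].
Qed.

End Bounds.

Lemma im_map (X Y X' Y' : eqType) (a : X -> X') (c : Y -> Y') (g : X -> seq Y)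
    (g' : X' -> seq Y') w : (forall x, g' (a x) = map c (g x)) ->
  im g' (map a w) = map c (im g w).
Proof. by move=> e; rewrite /im map_flatten -!map_comp; congr flatten; apply: eq_map. Qed.

Definition agree (X Y : eqType) k (f : 'I_k -> X -> seq Y) (w : seq X) : Prop :=
  forall i j, im (f i) w = im (f j) w.

(** The two alphabets are merged, because reducing a pair of morphisms exchanges
    their roles; letters of the target become undefined. *)
Lemma short_agreement (X Y : finType) k (f : 'I_k -> X -> seq Y) l w :
  (forall i x, f i x <> [::]) -> (forall i, marked (f i)) ->
  (forall i x, size (f i x) <= l) -> w <> [::] -> agree f w ->
  exists w', [/\ w' <> [::], agree f w' &
    size w' <= solution_bound (#|X| + #|Y|) l k].
Proof.
case: k f => [|k] f nf mf fl nw fw.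
  case: w nw {fw} => // x w _; exists [:: x].
  by split=> // -[].
pose T : finType := (X + Y)%type.
pose g i (z : T) : seq T := if z is inl x then map inr (f i x) else [::].
have gE i v : im (g i) (map inl v) = map inr (im (f i) v) by exact: im_map.
have inr_inj : injective (@inr X Y) by move=> x y [].
have mg i : marked (g i).
  move=> [x|x] [y|y] //= [z|z] //=; case fx: (f i x) => [|c s] //= [<-].
  case fy: (f i y) => [|d t] //= [dc]; congr inl.
  by apply: (mf i x y c); rewrite ?fx ?fy //= dc.
have gl i z : size (g i z) <= l by case: z => [x|x] //=; rewrite size_map.
have dg i v : defined (g i) (map inl v).
  by apply/allP => _ /mapP[x _ ->] /=; rewrite -size_eq0 size_map size_eq0; exact/eqP.
have [||v [nv ev sv]] := @short_solution T 'I_k.+1 (g ord0) g l (map inl w) (mg ord0) mg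
    (gl ord0) gl.
- by case: (w) nw.
- by move=> i; split; rewrite ?dg // !gE (fw ord0 i).
have [v' vE] : exists v', v = map inl v'.
  have [+ _ _] := ev ord0; elim: v {nv ev sv} => [|[x|y] v IHv] /=; first by exists [::].
    by move=> /andP[_ /IHv[v' ->]]; exists (x :: v').
  by [].
exists v'; split.
- by move=> v0; rewrite vE v0 in nv.
- suff e0 i : im (f ord0) v' = im (f i) v' by move=> i j; rewrite -e0.
  by have [_ _] := ev i; rewrite vE !gE; exact: inj_map.
- by move: sv; rewrite vE size_map card_sum card_ord.
Qed.

(** * Immersions as marked morphisms *)

Section FreeGroupWords.
Variable A : choiceType.
Implicit Types (x y : letter A) (u v w : seq (letter A)).

Lemma reduced_cat w x y v : reduced (rcons w x) -> reduced (y :: v) ->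
  y != inv_letter x -> reduced (rcons w x ++ y :: v).
Proof.
by case: w => [|z w] /= rw rv ne; rewrite ?ne // cat_path rw /= last_rcons ne.
Qed.

Lemma reduced_catNN w x v : ~~ reduced (rcons w x ++ inv_letter x :: v).
Proof. by case: w => [|z w] /=; rewrite ?cat_path /= ?last_rcons eqxx ?andbF. Qed.

Lemma reduced_prefix_max w : w <> [::] -> exists p x q,
  [/\ w = rcons p x ++ q, reduced (rcons p x) &
      q = [::] \/ exists q', q = inv_letter x :: q'].
Proof.
case: w => // x w _; elim: w x => [|y w IHw] x.
  by exists [::], x, [::]; split=> //; left.
have [->|nyx] := eqVneq y (inv_letter x).
  by exists [::], x, (inv_letter x :: w); split=> //; right; exists w.
have [p [z [q [e rp hq]]]] := IHw y.
exists (x :: p), z, q; split=> //; first by rewrite e.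
by case: p e rp => [|t p] /= [<- _]; rewrite nyx.
Qed.

End FreeGroupWords.

Section Immersions.
Variables Sigma Delta : choiceType.
Implicit Types (f : {multiplicative freegroup Sigma -> freegroup Delta}).
Implicit Types (x y : letter Sigma) (w : seq (letter Sigma)).

Definition letter_image f x : seq (letter Delta) := fgword (f (fgletter x)).

Lemma multiplicative1 f : f 1%g = 1%g.
Proof. by apply: (mulgI (f 1%g)); rewrite -gmulfM !mulg1. Qed.

Lemma letter_image_inv f x :
  letter_image f (inv_letter x) = inv_word (letter_image f x).
Proof.
have -> : letter_image f (inv_letter x) = fgword ((f (fgletter x))^-1)%g.
  congr fgword; apply: (mulgI (f (fgletter x))); rewrite -gmulfM mulgV.
  rewrite -[RHS](multiplicative1 f); congr (f _); apply: val_inj.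
  by rewrite /= eqxx.
by [].
Qed.

Lemma letter_image_last f x d s : letter_image f (inv_letter x) = d :: s ->
  exists r, letter_image f x = rcons r (inv_letter d).
Proof.
rewrite letter_image_inv => /(congr1 (@inv_word Delta)); rewrite inv_wordK => ->.
by exists (inv_word s); rewrite /inv_word /= rev_cons.
Qed.

Lemma immersion_nonempty f x : immersion f -> letter_image f x <> [::].
Proof. by case=> ne _; exact: ne. Qed.

Lemma immersion_marked f : immersion f -> marked (letter_image f).
Proof.
case=> _ inj x y c hx hy; apply: contrapT => /inj; rewrite -/(letter_image f x).
by rewrite hx -/(letter_image f y) hy.
Qed.

(** Between the images of two letters that do not cancel nothing cancels: the
    image of x ends with the inverse of the first letter of the image of x^-1. *)
Lemma immersion_reduced f w : immersion f -> reduced w ->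
  reduced (im (letter_image f) w).
Proof.
move=> fi; elim: w => //= x w IHw xw; have rw := path_sorted xw.
rewrite im_cons; case: w => [|y w] in IHw xw rw *; first by rewrite cats0; exact: valP.
have {}IHw := IHw rw; rewrite im_cons in IHw *.
case E: (letter_image f y) IHw => [|d s]; first by case: (immersion_nonempty fi E).
move=> IHw; case E': (letter_image f (inv_letter x)) => [|c t].
  by case: (immersion_nonempty fi E').
have [r rE] := letter_image_last E'; rewrite rE.
have rx : reduced (rcons r (inv_letter c)) by rewrite -rE; exact: valP.
apply: reduced_cat => //; rewrite inv_letterK; apply/eqP => dc.
move: xw => /= /andP[/eqP []]; apply: (immersion_marked fi (c := d)).
  by rewrite E.
by rewrite E' dc.
Qed.

Lemma immersion_im f (u : freegroup Sigma) : immersion f ->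
  fgword (f u) = im (letter_image f) u.
Proof.
move=> fi; case: u => w /=; elim: w => [|x w IHw] rw.
  have -> : FreeGroup rw = 1%g by apply: val_inj.
  by rewrite multiplicative1.
have rw' : reduced w := path_sorted rw.
have -> : FreeGroup rw = (fgletter x * FreeGroup rw')%g.
  by apply: val_inj; rewrite /= -[RHS]/(reduce (x :: w)) reduce_id.
rewrite gmulfM; change (reduce (letter_image f x ++ f (FreeGroup rw')) =
  letter_image f x ++ im (letter_image f) w).
by rewrite IHw reduce_id // -im_cons; exact: immersion_reduced.
Qed.

(** A common value of immersions at a word, reduced or not, ceases to be reduced
    exactly at the end of the image of the longest reduced prefix of the word,
    so that the immersions already agree on this prefix. *)
Lemma agree_reduced k (f : 'I_k -> {multiplicative freegroup Sigma -> freegroup Delta})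
    w : (forall i, immersion (f i)) -> w <> [::] -> agree (fun i => letter_image (f i)) w ->
  exists2 u : freegroup Sigma, u <> 1%g & forall i j, f i u = f j u.
Proof.
move=> fi /reduced_prefix_max[p [x [q [wE rp hq]]]] fw.
exists (FreeGroup rp); first by case: (p) rp => [|? ?] rp /(congr1 val).
suff le i j : size (im (letter_image (f j)) (rcons p x)) <=
    size (im (letter_image (f i)) (rcons p x)).
  move=> i j; apply: val_inj; rewrite /= !immersion_im //=.
  have /eqP := fw i j; rewrite wE !im_cat eqseq_cat; first by move=> /andP[/eqP].
  by apply/eqP; rewrite eqn_leq !le.
have /eqP := fw i j; rewrite wE !im_cat.
case: hq => [->|[q' ->]].
  by rewrite !cats0 => /eqP ->.
move=> /eqP e; rewrite leqNgt; apply/negP => lt.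
have [z jE iE] := cat_eq_split e (ltnW lt).
case: z => [|d z] in jE iE; first by rewrite jE cats0 ltnn in lt.
rewrite im_cons in iE.
case E: (letter_image (f i) (inv_letter x)) iE => [|d' s].
  by case: (immersion_nonempty (fi i) E).
case=> dd _; rewrite dd in E.
have [r rE] := letter_image_last E.
have := immersion_reduced (fi j) rp; rewrite jE -cats1 im_cat im_cons cats0 rE.
rewrite -rcons_cat -[d in d :: z]inv_letterK; apply/negP.
exact: reduced_catNN.
Qed.

End Immersions.

Lemma In_tnthP (X : Type) (x : X) (s : seq X) :
  List.In x s <-> exists i : 'I_(size s), tnth (in_tuple s) i = x.
Proof.
elim: s => [|y s IHs] /=; first by split=> // -[[]].
split=> [[->|/IHs[i <-]]|[i]].
- by exists ord0; rewrite (tnth_nth x).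
- by exists (lift ord0 i); rewrite !(tnth_nth x).
- rewrite (tnth_nth y); case: (unliftP ord0 i) => [j|] -> /=; last by left.
  by move=> jx; right; apply/IHs; exists j; rewrite (tnth_nth y).
Qed.

Lemma equaliser_set_trivial (Sigma Delta : choiceType)
    (S : seq {multiplicative freegroup Sigma -> freegroup Delta}) :
  (forall f, List.In f S -> immersion f) ->
  (equaliser_set [set f | List.In f S] = [set 1%g])%classic <->
  ~ exists2 w, w <> [::] &
    agree (fun i : 'I_(size S) => letter_image (tnth (in_tuple S) i)) w.
Proof.
move=> Si.
have fi i : immersion (tnth (in_tuple S) i) by apply/Si/In_tnthP; exists i.
split=> [E [w nw /(agree_reduced fi)-/(_ nw)[u nu fu]]|no].
  apply: nu; suff : equaliser_set [set f | List.In f S]%classic u by rewrite E.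
  by move=> g /In_tnthP[i <-] h /In_tnthP[j <-]; exact: fu.
apply/seteqP; split=> u; last by move=> -> g _ h _ /=;
  rewrite /equaliser /= !multiplicative1.
move=> fu; apply: contrapT => nu; apply: no; exists (fgword u).
  by move=> u0; apply: nu; apply: val_inj.
move=> i j; rewrite -!immersion_im //; congr fgword.
by apply: fu; apply/In_tnthP; [exists i|exists j].
Qed.

(** * A functional calculus for WHILE programs *)

(** Variable 0 carries the argument and the result.  Variable 1 is a stack that
    every program leaves as it found it, so that a program can save a value
    there while another one runs; all the other variables are scratch. *)
Definition computable (f : tree -> tree) : Prop :=
  exists p, forall s, exists s', [/\ exec p s s', s' 0 = f (s 0) & s' 1 = s 1].

Definition computable2 (f : tree -> tree -> tree) : Prop :=
  computable (fun t => f (tree_hd t) (tree_tl t)).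

Definition computable3 (f : tree -> tree -> tree -> tree) : Prop :=
  computable2 (fun x t => f x (tree_hd t) (tree_tl t)).

Lemma computable_expr e (f : tree -> tree) :
  (forall s, eval s e = f (s 0)) -> computable f.
Proof.
move=> ef; exists (Assign 0 e) => s; exists (update s 0 (eval s e)).
by split; [exact: exec_assign|exact: ef|].
Qed.

Lemma computable_id : computable (fun x => x).
Proof. exact: (@computable_expr (EVar 0)). Qed.

Lemma computable_nil : computable (fun=> Nil).
Proof. exact: (@computable_expr ENil). Qed.

Lemma computable_comp f g :
  computable f -> computable g -> computable (fun x => f (g x)).
Proof.
move=> [p fp] [q gq]; exists (Seq q p) => s.
have [s1 [e1 v1 t1]] := gq s; have [s2 [e2 v2 t2]] := fp s1.
exists s2; split; [exact: exec_seq e1 e2|by rewrite v2 v1|by rewrite t2].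
Qed.

Lemma computable_hd f : computable f -> computable (fun x => tree_hd (f x)).
Proof.
by apply: (@computable_comp tree_hd); exact: (@computable_expr (EHd (EVar 0))).
Qed.

Lemma computable_tl f : computable f -> computable (fun x => tree_tl (f x)).
Proof.
by apply: (@computable_comp tree_tl); exact: (@computable_expr (ETl (EVar 0))).
Qed.

Lemma computable_cons f g :
  computable f -> computable g -> computable (fun x => Cons (f x) (g x)).
Proof.
move=> [p fp] [q gq].
(* The argument is saved on the stack while f runs, and is then exchanged
   with the value of f, which stays on the stack while g runs. *)
exists (Seq (Assign 1 (ECons (EVar 0) (EVar 1)))
       (Seq p
       (Seq (Assign 2 (EVar 0))
       (Seq (Assign 0 (EHd (EVar 1)))
       (Seq (Assign 1 (ECons (EVar 2) (ETl (EVar 1))))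
       (Seq q
       (Seq (Assign 0 (ECons (EHd (EVar 1)) (EVar 0)))
            (Assign 1 (ETl (EVar 1)))))))))) => s.
have [s1 [e1 v1 t1]] := fp (update s 1 (Cons (s 0) (s 1))).
set s2 := update s1 2 (s1 0); set s3 := update s2 0 (tree_hd (s2 1)).
set s4 := update s3 1 (Cons (s3 2) (tree_tl (s3 1))).
have [s5 [e5 v5 t5]] := gq s4.
set s6 := update s5 0 (Cons (tree_hd (s5 1)) (s5 0)).
exists (update s6 1 (tree_tl (s6 1))); split.
- do ![apply: exec_seq; first exact: exec_assign] => //=.
  apply: exec_seq; first exact: e1.
  do ![apply: exec_seq; first exact: exec_assign] => //=.
  apply: exec_seq; first exact: e5.
  apply: exec_seq; first exact: exec_assign.
  exact: exec_assign.
- by rewrite /s6 /update /= t5 v5 /s4 /update /= /s3 /s2 /update /= v1 t1.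
- by rewrite /s6 /update /= t5 /s4 /update /= /s3 /s2 /update /= t1.
Qed.

Lemma computable_eq f g : computable f -> computable g ->
  computable (fun x => code_bool (f x == g x)).
Proof.
move=> cf cg.
apply: (@computable_comp (fun x => code_bool (tree_hd x == tree_tl x))
                         (fun x => Cons (f x) (g x))).
  exact: (@computable_expr (EEq (EHd (EVar 0)) (ETl (EVar 0)))).
exact: computable_cons.
Qed.

Lemma computable2_app f a b : computable2 f -> computable a -> computable b ->
  computable (fun x => f (a x) (b x)).
Proof.
move=> cf ca cb.
exact: (computable_comp cf (computable_cons ca cb)).
Qed.

Lemma computable3_app f a b c : computable3 f ->
  computable a -> computable b -> computable c ->
  computable (fun x => f (a x) (b x) (c x)).
Proof.
move=> cf ca cb cc.
exact: (computable_comp cf (computable_cons ca (computable_cons cb cc))).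
Qed.

(** A tree stands for the list of the left sons along its right spine, as in
    code_seq. *)
Fixpoint tree_foldl (step : tree -> tree -> tree) (acc l : tree) : tree :=
  if l is Cons e l' then tree_foldl step (step acc e) l' else acc.

(** The only use of the WHILE loop: each round replaces (x, (acc, e :: l)) by
    (x, (step x acc e, l)). *)
Lemma computable_foldl step init l :
  computable3 step -> computable init -> computable l ->
  computable (fun x => tree_foldl (step x) (init x) (l x)).
Proof.
move=> cstep cinit cl.
pose round t := Cons (tree_hd t)
  (Cons (step (tree_hd t) (tree_hd (tree_tl t)) (tree_hd (tree_tl (tree_tl t))))
        (tree_tl (tree_tl (tree_tl t)))).
have [p roundp] : computable round.
  have chd := computable_hd computable_id.
  have ctl := computable_tl computable_id.
  apply: computable_cons => //; apply: computable_cons.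
    apply: computable3_app => //; first exact: computable_hd.
    exact/computable_hd/computable_tl.
  exact/computable_tl/computable_tl.
pose F x := tree_foldl (step (tree_hd x)) (tree_hd (tree_tl x)) (tree_tl (tree_tl x)).
apply: (@computable_comp F (fun x => Cons x (Cons (init x) (l x)))); last first.
  apply: computable_cons; first exact: computable_id.
  exact: computable_cons.
exists (Seq (While (ETl (ETl (EVar 0))) p) (Assign 0 (EHd (ETl (EVar 0))))) => s.
suff [s' [es' v' t']] : exists s', [/\ exec (While (ETl (ETl (EVar 0))) p) s s',
    tree_hd (tree_tl (s' 0)) = F (s 0) & s' 1 = s 1].
  exists (update s' 0 (tree_hd (tree_tl (s' 0)))); split=> //.
  by apply: exec_seq es' _; exact: exec_assign.
rewrite {}/F; move def_r: (tree_tl (tree_tl (s 0))) => r.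
elim: r s def_r => [|e _ r IHr] s sE.
  by exists s; split=> //; apply: exec_while_false.
have [s1 [e1 v1 t1]] := roundp s.
have [|s2 [e2 v2 t2]] := IHr s1; first by rewrite v1 /round /= sE.
exists s2; split; last by rewrite t2.
  by apply: exec_while_true e1 e2; rewrite /= sE.
by rewrite v2 v1 /round /= sE.
Qed.

Definition tree_if (c a b : tree) : tree := if c is Nil then b else a.

(** A conditional is a fold over a list of length at most one. *)
Lemma computable_if c a b : computable c -> computable a -> computable b ->
  computable (fun x => tree_if (c x) (a x) (b x)).
Proof.
move=> cc ca cb.
pose g x := tree_foldl (fun _ _ => b x) (a x) (code_bool (c x == Nil)).
have -> : (fun x => tree_if (c x) (a x) (b x)) = g.
  by apply/funext => x; rewrite /g; case: (c x).
apply: (@computable_foldl (fun x _ _ => b x)) => //.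
  exact: (computable_comp cb (computable_hd computable_id)).
exact: computable_eq cc computable_nil.
Qed.

Create HintDb computable.

(** The functions of the program are written with the closure operations only, so
    that their computability is read off their bodies. *)
Ltac computability :=
  cbv beta; rewrite /computable3 /computable2;
  match goal with |- computable ?f => change (computable (fun x => f x)) end;
  cbv beta;
  lazymatch goal with
  | |- computable (fun x => x) => exact: computable_id
  | |- computable (fun x => Nil) => exact: computable_nil
  | |- computable (fun x => Cons _ _) => apply: computable_cons; computability
  | |- computable (fun x => tree_hd _) => apply: computable_hd; computability
  | |- computable (fun x => tree_tl _) => apply: computable_tl; computability
  | |- computable (fun x => code_bool (_ == _)) =>
      apply: computable_eq; computability
  | |- computable (fun x => tree_if _ _ _) => apply: computable_if; computability
  | |- computable (fun x => tree_foldl _ _ _) =>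
      apply: computable_foldl; computability
  | |- computable (fun x => _ _ _ _) =>
      apply: computable3_app; [by auto with computable|computability ..]
  | |- computable (fun x => _ _ _) =>
      apply: computable2_app; [by auto with computable|computability ..]
  | |- computable (fun x => ?f _) =>
      apply: (@computable_comp f); [by auto with computable|computability]
  end.

(** * The search program *)

Definition tree_revcat (s t : tree) : tree :=
  tree_foldl (fun acc e => Cons e acc) t s.

Definition tree_cat (s t : tree) : tree := tree_revcat (tree_revcat s Nil) t.

(** A tree also stands for the length of its right spine, in agreement with
    code_nat but for any labels, so that concatenation is addition and every list
    of the input can serve as a number. *)
Fixpoint tree_size (t : tree) : nat := if t is Cons _ t' then (tree_size t').+1 else 0.

Definition tree_mul (s t : tree) : tree := tree_foldl (fun acc _ => tree_cat t acc) Nil s.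

Definition tree_exp (s t : tree) : tree :=
  tree_foldl (fun acc _ => tree_mul s acc) (Cons Nil Nil) t.

Definition tree_inv (u : tree) : tree :=
  tree_foldl (fun acc y => Cons (Cons (tree_hd y) (code_bool (tree_tl y == Nil))) acc)
    Nil u.

Definition tree_nth (s i : tree) : tree :=
  tree_hd (tree_foldl (fun acc _ => tree_tl acc) s i).

(** The input lists the images of the generators only; the image of an inverse
    letter is computed from it. *)
Definition tree_image1 (f x : tree) : tree :=
  tree_if (tree_tl x) (tree_inv (tree_nth f (tree_hd x))) (tree_nth f (tree_hd x)).

Definition tree_image (f w : tree) : tree :=
  tree_foldl (fun acc x => tree_cat acc (tree_image1 f x)) Nil w.

Definition tree_total (S : tree) : tree :=
  tree_foldl (fun acc f => tree_foldl (fun acc' u => tree_cat u acc') acc f) Nil S.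

(** The state of the fold is the number of the next generator together with the
    letters listed so far. *)
Definition tree_letters (n : tree) : tree :=
  tree_tl (tree_foldl (fun st _ =>
    Cons (Cons Nil (tree_hd st))
      (Cons (Cons (tree_hd st) Nil)
        (Cons (Cons (tree_hd st) (Cons Nil Nil)) (tree_tl st)))) (Cons Nil Nil) n).

Definition tree_extend (L W : tree) : tree :=
  Cons Nil (tree_foldl (fun acc w => tree_foldl (fun acc' x => Cons (Cons x w) acc') acc L)
    Nil W).

Definition tree_words (L b : tree) : tree :=
  tree_foldl (fun W _ => tree_extend L W) (Cons Nil Nil) b.

Definition tree_solves (S w : tree) : tree :=
  tree_if w
    (tree_foldl (fun acc f =>
       tree_if acc (code_bool (tree_image f w == tree_image (tree_hd S) w)) Nil)
       (Cons Nil Nil) S)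
    Nil.

Definition tree_unsolvable (S W : tree) : tree :=
  tree_foldl (fun acc w => tree_if (tree_solves S w) Nil acc) (Cons Nil Nil) W.

Definition tree_word_card (m b : tree) : tree := tree_exp (Cons Nil m) b.

Definition tree_value_bound (m l : tree) : tree := Cons Nil (tree_mul m l).

Definition tree_prime_bound (m l : tree) : tree :=
  tree_exp (tree_value_bound m l)
    (tree_mul (tree_mul (tree_exp (tree_word_card m (tree_value_bound m l)) m)
                        (tree_exp (tree_word_card m (tree_value_bound m l)) m)) m).

Definition tree_solution_bound (m l k : tree) : tree :=
  tree_exp (tree_word_card m (tree_prime_bound m l)) k.

(** The bound is applied with the size 2 (|Sigma| + |Delta|) of the merged alphabet
    and with the total length of the words of the input as a bound on each. *)
Definition tree_decide (t : tree) : tree :=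
  tree_unsolvable (tree_tl (tree_tl t))
    (tree_words (tree_letters (tree_hd t))
      (tree_solution_bound
         (tree_cat (tree_cat (tree_hd t) (tree_hd (tree_tl t)))
                   (tree_cat (tree_hd t) (tree_hd (tree_tl t))))
         (tree_total (tree_tl (tree_tl t)))
         (tree_tl (tree_tl t)))).

Lemma computable_revcat : computable2 tree_revcat.
Proof. rewrite /tree_revcat; computability. Qed.
#[local] Hint Resolve computable_revcat : computable.

Lemma computable_cat : computable2 tree_cat.
Proof. rewrite /tree_cat; computability. Qed.
#[local] Hint Resolve computable_cat : computable.

Lemma computable_mul : computable2 tree_mul.
Proof. rewrite /tree_mul; computability. Qed.
#[local] Hint Resolve computable_mul : computable.

Lemma computable_exp : computable2 tree_exp.
Proof. rewrite /tree_exp; computability. Qed.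
#[local] Hint Resolve computable_exp : computable.

Lemma computable_inv : computable tree_inv.
Proof. rewrite /tree_inv; computability. Qed.
#[local] Hint Resolve computable_inv : computable.

Lemma computable_nth : computable2 tree_nth.
Proof. rewrite /tree_nth; computability. Qed.
#[local] Hint Resolve computable_nth : computable.

Lemma computable_image1 : computable2 tree_image1.
Proof. rewrite /tree_image1; computability. Qed.
#[local] Hint Resolve computable_image1 : computable.

Lemma computable_image : computable2 tree_image.
Proof. rewrite /tree_image; computability. Qed.
#[local] Hint Resolve computable_image : computable.

Lemma computable_total : computable tree_total.
Proof. rewrite /tree_total; computability. Qed.
#[local] Hint Resolve computable_total : computable.

Lemma computable_letters : computable tree_letters.
Proof. rewrite /tree_letters; computability. Qed.
#[local] Hint Resolve computable_letters : computable.

Lemma computable_extend : computable2 tree_extend.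
Proof. rewrite /tree_extend; computability. Qed.
#[local] Hint Resolve computable_extend : computable.

Lemma computable_words : computable2 tree_words.
Proof. rewrite /tree_words; computability. Qed.
#[local] Hint Resolve computable_words : computable.

Lemma computable_solves : computable2 tree_solves.
Proof. rewrite /tree_solves; computability. Qed.
#[local] Hint Resolve computable_solves : computable.

Lemma computable_unsolvable : computable2 tree_unsolvable.
Proof. rewrite /tree_unsolvable; computability. Qed.
#[local] Hint Resolve computable_unsolvable : computable.

Lemma computable_word_card : computable2 tree_word_card.
Proof. rewrite /tree_word_card; computability. Qed.
#[local] Hint Resolve computable_word_card : computable.

Lemma computable_value_bound : computable2 tree_value_bound.
Proof. rewrite /tree_value_bound; computability. Qed.
#[local] Hint Resolve computable_value_bound : computable.

Lemma computable_prime_bound : computable2 tree_prime_bound.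
Proof. rewrite /tree_prime_bound; computability. Qed.
#[local] Hint Resolve computable_prime_bound : computable.

Lemma computable_solution_bound : computable3 tree_solution_bound.
Proof. rewrite /tree_solution_bound; computability. Qed.
#[local] Hint Resolve computable_solution_bound : computable.

Lemma computable_decide : computable tree_decide.
Proof. rewrite /tree_decide; computability. Qed.

(** * Correctness of the search program *)

Lemma tree_foldl_code (X : Type) (code : X -> tree) step acc s :
  tree_foldl step acc (code_seq code s) = foldl (fun a x => step a (code x)) acc s.
Proof. by elim: s acc => //= x s IHs acc; rewrite IHs. Qed.

Lemma tree_foldl_iter F acc t :
  tree_foldl (fun a _ => F a) acc t = iter (tree_size t) F acc.
Proof. by elim: t acc => //= _ _ t IHt acc; rewrite IHt -iterSr. Qed.

Lemma tree_size_nat n : tree_size (code_nat n) = n.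
Proof. by elim: n => //= n ->. Qed.

Lemma tree_size_seq X (code : X -> tree) s : tree_size (code_seq code s) = size s.
Proof. by elim: s => //= x s ->. Qed.

Lemma tree_size_revcat s t : tree_size (tree_revcat s t) = tree_size s + tree_size t.
Proof.
rewrite /tree_revcat; elim: s t => //= x _ s IHs t.
by rewrite IHs addSnnS.
Qed.

Lemma tree_size_cat s t : tree_size (tree_cat s t) = tree_size s + tree_size t.
Proof. by rewrite /tree_cat !tree_size_revcat addn0. Qed.

Lemma tree_size_mul s t : tree_size (tree_mul s t) = tree_size s * tree_size t.
Proof.
rewrite /tree_mul tree_foldl_iter; elim: (tree_size s) => //= n IHn.
by rewrite tree_size_cat IHn mulSn.
Qed.

Lemma tree_size_exp s t : tree_size (tree_exp s t) = tree_size s ^ tree_size t.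
Proof.
rewrite /tree_exp tree_foldl_iter; elim: (tree_size t) => //= n IHn.
by rewrite tree_size_mul IHn expnS.
Qed.

Lemma tree_size_solution_bound m l k : tree_size (tree_solution_bound m l k) =
  solution_bound (tree_size m) (tree_size l) (tree_size k).
Proof.
rewrite /tree_solution_bound /tree_prime_bound /tree_word_card /tree_value_bound.
by do ![rewrite ?tree_size_exp ?tree_size_mul /=].
Qed.

Lemma tree_size_foldl step acc t :
  (forall a e, tree_size a <= tree_size (step a e)) ->
  tree_size acc <= tree_size (tree_foldl step acc t).
Proof.
by move=> up; elim: t acc => //= e _ t IHt acc; exact: leq_trans (up _ _) (IHt _).
Qed.

Lemma tree_size_foldl_in (X : Type) (code : X -> tree) step acc s x n :
  (forall a e, tree_size a <= tree_size (step a e)) ->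
  (forall a, n <= tree_size (step a (code x))) -> List.In x s ->
  n <= tree_size (tree_foldl step acc (code_seq code s)).
Proof.
move=> up big; elim: s acc => //= y s IHs acc [->|/IHs //].
exact: leq_trans (big _) (tree_size_foldl _ _ up).
Qed.

Lemma tree_foldl_and (X : Type) (code : X -> tree) (P : tree -> bool) b s :
  tree_foldl (fun acc e => tree_if acc (code_bool (P e)) Nil) (code_bool b)
    (code_seq code s) = code_bool (b && all (P \o code) s).
Proof.
rewrite tree_foldl_code; elim: s b => [|x s IHs] [] //=.
exact: (IHs false).
Qed.

Lemma tree_foldl_none (X : Type) (code : X -> tree) (F : tree -> tree) b s :
  tree_foldl (fun acc e => tree_if (F e) Nil acc) (code_bool b) (code_seq code s) =
  code_bool (b && all (fun x => F (code x) == Nil) s).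
Proof.
rewrite tree_foldl_code; elim: s b => [|x s IHs] b /=; first by rewrite andbT.
case: (F (code x)) => [|? ?] /=; first exact: IHs.
by rewrite (IHs false) andbF.
Qed.

Section Codes.
Variables (X : Type) (code : X -> tree).

Lemma tree_revcat_code s t :
  tree_revcat (code_seq code s) (code_seq code t) = code_seq code (catrev s t).
Proof.
by rewrite /tree_revcat tree_foldl_code; elim: s t => //= x s IHs t; rewrite -IHs.
Qed.

Lemma tree_cat_code s t :
  tree_cat (code_seq code s) (code_seq code t) = code_seq code (s ++ t).
Proof.
rewrite /tree_cat -[Nil]/(code_seq code [::]) !tree_revcat_code.
by rewrite !catrevE cats0 revK.
Qed.

Lemma code_seq_inj : injective code -> injective (code_seq code).
Proof.
move=> inj; elim=> [|x s IHs] [|y t] //= [/inj -> e].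
by rewrite (IHs t).
Qed.

Lemma tree_nth_code s i x : i < size s ->
  tree_nth (code_seq code s) (code_nat i) = code (nth x s i).
Proof.
rewrite /tree_nth tree_foldl_iter tree_size_nat.
elim: i s => [|i IHi] [|y s] //= si.
by rewrite -iterS iterSr /= IHi.
Qed.

End Codes.

Lemma code_nat_inj : injective code_nat.
Proof. exact: can_inj tree_size_nat. Qed.

Lemma code_letter_inj (A : finType) : injective (@code_letter A).
Proof.
move=> [a b] [c d] /= [/code_nat_inj/val_inj/enum_rank_inj -> e].
by congr pair; case: b d e => [] [].
Qed.

Lemma tree_inv_code (A : finType) (u : seq (letter A)) :
  tree_inv (code_seq (@code_letter A) u) = code_seq (@code_letter A) (inv_word u).
Proof.
rewrite /tree_inv tree_foldl_code /inv_word -[rev _]cats0 -catrevE.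
set step := fun _ _ => _.
suff gen t : foldl step (code_seq (@code_letter A) t) u =
  code_seq (@code_letter A) (catrev (map (@inv_letter A) u) t) by exact: (gen [::]).
elim: u t => //= x u IHu t; rewrite -(IHu (inv_letter x :: t)); congr foldl.
by case: x => a [].
Qed.

(** The program knows a letter by the number of its generator and its sign. *)
Definition numbered_letters n : seq (nat * bool) :=
  iteri n (fun i s => [:: (i, false), (i, true) & s]) [::].

Definition code_numbered (x : nat * bool) : tree := Cons (code_nat x.1) (code_bool x.2).

Lemma tree_letters_code n :
  tree_letters (code_nat n) = code_seq code_numbered (numbered_letters n).
Proof.
rewrite /tree_letters tree_foldl_iter tree_size_nat.
set st := iter _ _ _.
suff -> : st = Cons (code_nat n) (code_seq code_numbered (numbered_letters n)) by [].
by rewrite {}/st; elim: n => //= n ->.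
Qed.

Lemma mem_numbered_letters n x : (x \in numbered_letters n) = (x.1 < n).
Proof.
elim: n => //= n IHn; rewrite !inE IHn ltnS [x.1 <= n]leq_eqVlt orbA.
by congr (_ || _); case: x {IHn} => i [] /=; rewrite !xpair_eqE ?andbT ?andbF ?orbF.
Qed.

Lemma mem_foldl_cons (X : eqType) (L : seq X) (W : seq (seq X)) v :
  (v \in foldl (fun acc w => foldl (fun acc' x => (x :: w) :: acc') acc L) [::] W) =
  if v is x :: w then (x \in L) && (w \in W) else false.
Proof.
have inner w acc : (v \in foldl (fun acc' x => (x :: w) :: acc') acc L) =
    (v \in acc) || (if v is x :: w' then (x \in L) && (w' == w) else false).
  elim: L acc => [|y L IHL] acc /=; first by case: v => *; rewrite orbF.
  rewrite IHL inE; case: v {IHL} => [|x v]; first by rewrite orbF.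
  by rewrite inE eqseq_cons; case: (x == y); case: (v == w); case: (_ \in acc);
    rewrite ?andbT ?andbF ?orbT.
suff outer acc : (v \in foldl (fun acc w =>
    foldl (fun acc' x => (x :: w) :: acc') acc L) acc W) =
    (v \in acc) || (if v is x :: w then (x \in L) && (w \in W) else false).
  by rewrite outer.
elim: W acc => [|w W IHW] acc /=; first by case: v {inner} => *; rewrite ?andbF orbF.
rewrite IHW inner; case: v {IHW inner} => [|x v]; first by rewrite !orbF.
by rewrite inE -orbA -andb_orr.
Qed.

Definition bounded_words (X : Type) (L : seq X) b : seq (seq X) :=
  iter b (fun W => [::] :: foldl (fun acc w =>
    foldl (fun acc' x => (x :: w) :: acc') acc L) [::] W) [:: [::]].

Lemma mem_bounded_words (X : eqType) (L : seq X) b w :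
  (w \in bounded_words L b) = (size w <= b) && all (mem L) w.
Proof.
elim: b w => [|b IHb] [|x w] //=; rewrite inE /= mem_foldl_cons //.
by rewrite -/(bounded_words L b) IHb ltnS andbCA.
Qed.

Lemma tree_words_code (X : Type) (code : X -> tree) L b :
  tree_words (code_seq code L) b =
  code_seq (code_seq code) (bounded_words L (tree_size b)).
Proof.
rewrite /tree_words tree_foldl_iter; elim: (tree_size b) => //= n ->.
rewrite /tree_extend /=; congr Cons; rewrite tree_foldl_code.
rewrite -/(bounded_words L n); move: (bounded_words L n) => W.
suff gen acc : foldl (fun a w =>
     tree_foldl (fun acc' x => Cons (Cons x (code_seq code w)) acc') a (code_seq code L))
     (code_seq (code_seq code) acc) W =
  code_seq (code_seq code) (foldl (fun acc w =>
     foldl (fun acc' x => (x :: w) :: acc') acc L) acc W) by exact: (gen [::]).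
elim: W acc => //= w W IHW acc; rewrite -IHW; congr foldl.
rewrite tree_foldl_code; elim: (L) acc => //= x L' IHL acc.
by rewrite -IHL.
Qed.

Section Decision.
Variables Sigma Delta : finType.
Implicit Types (f : {multiplicative freegroup Sigma -> freegroup Delta}).
Implicit Types (S : seq {multiplicative freegroup Sigma -> freegroup Delta}).
Implicit Types (w : seq (letter Sigma)).

Local Notation code_word := (code_seq (@code_letter Sigma)).

Lemma tree_image1_code f (x : letter Sigma) :
  tree_image1 (code_morphism f) (code_letter x) =
  code_seq (@code_letter Delta) (letter_image f x).
Proof.
case: x => a b; rewrite /tree_image1 /code_letter /=.
rewrite (tree_nth_code _ (f (fgletter (a, false)))); last first.
  by rewrite size_map -cardE ltn_ord.
rewrite (nth_map a) -?cardE ?ltn_ord // nth_enum_rank.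
case: b => //=; rewrite /code_fg tree_inv_code; congr code_seq.
exact/esym/(letter_image_inv f (a, false)).
Qed.

Lemma tree_image_code f w : tree_image (code_morphism f) (code_word w) =
  code_seq (@code_letter Delta) (im (letter_image f) w).
Proof.
rewrite /tree_image tree_foldl_code.
set step := fun _ _ => _.
suff gen t : foldl step (code_seq (@code_letter Delta) t) w =
  code_seq (@code_letter Delta) (t ++ im (letter_image f) w) by exact: (gen [::]).
elim: w t => [|x w IHw] t /=; first by rewrite cats0.
by rewrite /step tree_image1_code tree_cat_code IHw -catA.
Qed.

Lemma letter_image_size S f (x : letter Sigma) : List.In f S ->
  size (letter_image f x) <= tree_size (tree_total (code_seq (@code_morphism Sigma Delta) S)).
Proof.
move=> fS.
have -> : size (letter_image f x) = size (letter_image f (x.1, false)).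
  case: x => a [] //=; rewrite -[(a, true)]/(inv_letter (a, false)).
  by rewrite letter_image_inv size_rev size_map.
have up a e : tree_size a <= tree_size (tree_cat e a).
  by rewrite tree_size_cat leq_addl.
apply: tree_size_foldl_in fS => [a g|a]; first exact: tree_size_foldl.
apply: (@tree_size_foldl_in _ _ _ _ _ (f (fgletter (x.1, false)))) => // [b|].
  by rewrite tree_size_cat tree_size_seq leq_addr.
apply: (List.in_map (fun b => f (fgletter (b, false)))).
elim: (enum Sigma) (mem_enum Sigma x.1) => //= b s IHs.
by rewrite inE => /orP[/eqP->|/IHs]; [left|right].
Qed.

Lemma tree_solvesE S w :
  tree_solves (code_seq (@code_morphism Sigma Delta) S) (code_word w) <> Nil <->
  w <> [::] /\ agree (fun i : 'I_(size S) => letter_image (tnth (in_tuple S) i)) w.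
Proof.
case: w => [|x w]; first by split=> // -[].
set v := x :: w; rewrite /tree_solves.
rewrite (tree_foldl_and _ (fun t => _ == _) true) [tree_if _ _ _]/=.
set T := tree_hd _; set P := fun t => tree_image t (code_word v) == tree_image T (code_word v).
suff allE : all (P \o @code_morphism Sigma Delta) S <->
    agree (fun i : 'I_(size S) => letter_image (tnth (in_tuple S) i)) v.
  split=> [nz|[_ /allE ->]] //; split=> //; apply/allE.
  by case: (all _ _) nz.
case: S @T @P => [|f S] T P; first by split=> // _ [].
have PE i : P (code_morphism (tnth (in_tuple (f :: S)) i)) =
    (im (letter_image (tnth (in_tuple (f :: S)) i)) v == im (letter_image f) v).
  rewrite /P /T [tree_hd _]/= !tree_image_code; apply/inj_eq/code_seq_inj/code_letter_inj.
split=> [/(all_tnthP (t := in_tuple (f :: S))) fP i j|fP].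
  by have := fP j; have := fP i; rewrite /= !PE => /eqP-> /eqP->.
apply/(all_tnthP (t := in_tuple (f :: S))) => i; rewrite /= PE.
by apply/eqP; exact: (fP i ord0).
Qed.

Lemma numbered_word (v : seq (nat * bool)) :
  all (mem (numbered_letters #|Sigma|)) v ->
  exists w, code_word w = code_seq code_numbered v.
Proof.
elim: v => [|[i b] v IHv] /=; first by exists [::].
rewrite mem_numbered_letters => /andP[/= il /IHv[w wE]].
by exists ((enum_val (Ordinal il), b) :: w); rewrite /= wE /code_letter /= enum_valK.
Qed.

Lemma word_numbered w : exists2 v, code_word w = code_seq code_numbered v &
  size v = size w /\ all (mem (numbered_letters #|Sigma|)) v.
Proof.
exists [seq (enum_rank x.1 : nat, x.2) | x <- w].
  by elim: w => //= x w ->.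
split; first by rewrite size_map.
by apply/allP => _ /mapP[x _ ->]; rewrite /= mem_numbered_letters /=.
Qed.

Lemma tree_decideE S : (forall f, List.In f S -> immersion f) ->
  exists2 b : bool, tree_decide (code_instance S) = code_bool b &
    b <-> ~ exists2 w, w <> [::] &
      agree (fun i : 'I_(size S) => letter_image (tnth (in_tuple S) i)) w.
Proof.
move=> Si; rewrite /tree_decide /code_instance; cbn [tree_hd tree_tl].
set d := tree_cat _ _; set SS := code_seq _ S.
rewrite tree_letters_code tree_words_code tree_size_solution_bound.
set W := bounded_words _ _.
rewrite /tree_unsolvable (tree_foldl_none _ _ true) andTb.
exists (all (fun v => tree_solves SS (code_seq code_numbered v) == Nil) W) => //.
have fi i : immersion (tnth (in_tuple S) i) by apply/Si/In_tnthP; exists i.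
split=> [/allP none [w nw fw]|none].
  have nonempty i x : letter_image (tnth (in_tuple S) i) x <> [::].
    exact: immersion_nonempty.
  have mk i : marked (letter_image (tnth (in_tuple S) i)) by exact: immersion_marked.
  have le i x : size (letter_image (tnth (in_tuple S) i) x) <= tree_size (tree_total SS).
    by apply: letter_image_size; apply/In_tnthP; exists i.
  have [w' [nw' fw' sw']] := @short_agreement (Sigma * bool)%type (Delta * bool)%type
    _ _ _ _ nonempty mk le nw fw.
  have [v vE [sv vL]] := word_numbered w'.
  have /none/eqP : v \in W.
    rewrite mem_bounded_words vL andbT sv (leq_trans sw') //.
    rewrite !card_prod card_bool !muln2 -!addnn /d !tree_size_cat !tree_size_nat.
    by rewrite tree_size_seq addnACA.
  rewrite -vE; apply/tree_solvesE; by split.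
apply/allP => v; rewrite mem_bounded_words => /andP[_ /numbered_word[w wE]].
rewrite -wE; apply/eqP; apply: contrapT => /tree_solvesE[nw fw].
by apply: none; exists w.
Qed.

End Decision.

Local Open Scope classical_set_scope.
Local Open Scope group_scope.

Theorem corollary4 :
  exists p : program,
    forall (Sigma Delta : finType)
           (S : seq {multiplicative freegroup Sigma -> freegroup Delta}),
      (forall f, List.In f S -> immersion f) ->
      decides p (code_instance S)
        (equaliser_set [set f | List.In f S] = [set 1]).
Proof.
have [p pP] := computable_decide; exists p => Sigma Delta S Si.
have [b bE bP] := tree_decideE Si.
exists b; first exact: iff_trans bP (iff_sym (equaliser_set_trivial Si)).
have [s [es s0 _]] := pP (update (fun=> Nil) 0 (code_instance S)).
by exists s => //; rewrite s0 -bE.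
Qed.
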